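(* Let $a\in\mathcal K(\mathcal H)$ be normal. Then $b\in\overline{\mathcal O_{\mathcal B(\mathcal H)}(a)}^{\|\cdot\|}$ if and only if there exists $v\in\mathcal V_a$ with $b=vav^*$. In that case, $a=v^*bv$ and $vv^*=p_b$.
   Context: $\mathcal H$ is a separable infinite-dimensional complex Hilbert space, $\mathcal K(\mathcal H)$ the compact operators on it. $\mathcal O_{\mathcal B(\mathcal H)}(a)=\{uau^*\mid u\text{ unitary on }\mathcal H\}$, and $\overline{\,\cdot\,}^{\|\cdot\|}$ is the closure in the operator norm. For a normal operator $a$, $p_a$ is the orthogonal projection onto the closure of the range of $a$, and $\mathcal V_a=\{v\in\mathcal B(\mathcal H)\mid v^*v=p_a\}$ is the set of partial isometries with initial space $\overline{\operatorname{Ran}a}$. *)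

(* Defs.v *)
From HB Require Import structures.
From mathcomp Require Import all_boot all_order all_algebra.
From mathcomp Require Import complex.
From mathcomp Require Import all_classical all_reals all_analysis.

Set Implicit Arguments.
Unset Strict Implicit.
Unset Printing Implicit Defensive.

Import Order.TTheory GRing.Theory Num.Theory.
Import numFieldNormedType.Exports.

Local Open Scope classical_set_scope.
Local Open Scope ring_scope.
Local Open Scope complex_scope.

(* The inner product is linear in its first argument and conjugate-linear in
   its second one. *)
HB.mixin Record CompleteNormedModule_isHilbert (R : realType) V
    & CompleteNormedModule R[i] V := {
  inner : {dot V for (@Num.conj R[i])};
  sqr_norm_inner : forall x : V, `|x| ^+ 2 = inner x x
}.

#[short(type="hilbertType")]
HB.structure Definition Hilbert (R : realType) :=
  {V of CompleteNormedModule R[i] V & CompleteNormedModule_isHilbert R V}.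

Definition separable_space (T : topologicalType) :=
  exists2 D : set T, countable D & dense D.

Definition infinite_dimensional (K : nzRingType) (V : lmodType K) :=
  ~ exists n (e : 'I_n -> V),
      forall x, exists c : 'I_n -> K, x = \sum_(i < n) c i *: e i.

Section BoundedOperators.
Context {R : realType} {V : normedModType R[i]}.

Definition bounded_operator : {pred V -> V} := fun f =>
  `[< linear f /\ exists M : R, forall x, `|f x| <= M%:C * `|x| >].

Lemma bounded_operator_submod : submod_closed bounded_operator.
Proof.
split=> [|c f g /asboolP[lf [M fM]] /asboolP[lg [N gN]]]; apply/asboolP.
  split=> [k x y|]; first by rewrite /= scaler0 addr0.
  by exists 0 => x; rewrite normr0 mul0r.
split=> [k x y|].
  rewrite -[LHS]/(c *: f (k *: x + y) + g (k *: x + y)) lf lg.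
  by rewrite 2!scalerDr addrACA !scalerA mulrC.
exists (complex.Re `|c| * M + N) => x.
rewrite rmorphD rmorphM /= (RRe_real (normr_real c)) mulrDl.
apply: (le_trans (ler_normD _ _)); rewrite lerD// normrZ -mulrA ler_wpM2l//.
Qed.

HB.instance Definition _ :=
  GRing.isSubmodClosed.Build R[i] (V -> V) bounded_operator
    bounded_operator_submod.

End BoundedOperators.

Record bop (R : realType) (V : normedModType R[i]) := Bop {
  bop_fun :> V -> V;
  bop_funP : bop_fun \in bounded_operator
}.

HB.instance Definition _ (R : realType) (V : normedModType R[i]) :=
  [isSub of bop V for @bop_fun R V].
HB.instance Definition _ (R : realType) (V : normedModType R[i]) :=
  [Choice of bop V by <:].
HB.instance Definition _ (R : realType) (V : normedModType R[i]) :=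
  [SubChoice_isSubLmodule of bop V by <:].

Section OperatorNorm.
Context {R : realType} {V : normedModType R[i]}.
Implicit Types f g : bop V.

(* The norm of V takes its (real) values in R[i], hence Re. *)
Definition opnorm_set f : set R :=
  [set complex.Re `|f x| | x in [set x : V | `|x| <= 1]].

Definition opnorm f : R[i] := (sup (opnorm_set f))%:C.

Lemma ReK_norm (x : V) : (complex.Re `|x|)%:C = `|x|.
Proof. exact: RRe_real. Qed.

Lemma bop0 f : f 0 = 0.
Proof.
have /asboolP[lf _] := bop_funP f.
by have := lf (-1) 0 0; rewrite scaleN1r oppr0 addr0 scaleN1r addNr.
Qed.

Lemma bopZ f c x : f (c *: x) = c *: f x.
Proof.
by have /asboolP[lf _] := bop_funP f; have := lf c x 0; rewrite bop0 !addr0.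
Qed.

Lemma has_sup_opnorm f : has_sup (opnorm_set f).
Proof.
split; first by exists (complex.Re `|f 0|); exists 0 => //=; rewrite normr0.
have /asboolP[_ [M fM]] := bop_funP f.
exists `|M| => _ [x x1 <-]; rewrite -lecR ReK_norm (le_trans (fM x))//.
apply: (@le_trans _ _ (`|M|%:C * `|x|)).
  by rewrite ler_wpM2r// lecR ler_norm.
by rewrite ler_piMr// (lecR 0).
Qed.

Lemma opnorm_ub f x : `|x| <= 1 -> `|f x| <= opnorm f.
Proof.
move=> x1; rewrite -ReK_norm lecR; apply: ub_le_sup.
  exact: (has_sup_opnorm f).2.
by exists x.
Qed.

Lemma opnorm_ge0 f : 0 <= opnorm f.
Proof. by rewrite (le_trans (normr_ge0 (f 0)))// opnorm_ub// normr0. Qed.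

Lemma opnorm_le f (M : R) :
  (forall x, `|x| <= 1 -> `|f x| <= M%:C) -> opnorm f <= M%:C.
Proof.
move=> fM; rewrite lecR; apply: ge_sup; first exact: (has_sup_opnorm f).1.
by move=> _ [x x1 <-]; rewrite -lecR ReK_norm fM.
Qed.

Lemma opnormD f g : opnorm (f + g) <= opnorm f + opnorm g.
Proof.
rewrite -rmorphD; apply: opnorm_le => x x1.
by rewrite rmorphD (le_trans (ler_normD _ _))// lerD// opnorm_ub.
Qed.

Lemma opnorm_le_scale (c : R[i]) f : opnorm (c *: f) <= `|c| * opnorm f.
Proof.
rewrite -(RRe_real (normr_real c)) -rmorphM; apply: opnorm_le => x x1.
by rewrite rmorphM /= (RRe_real (normr_real c)) normrZ ler_wpM2l// opnorm_ub.
Qed.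

Lemma opnormZ (c : R[i]) f : opnorm (c *: f) = `|c| * opnorm f.
Proof.
apply/le_anti; rewrite opnorm_le_scale/=.
have [->|c0] := eqVneq c 0; first by rewrite normr0 mul0r opnorm_ge0.
rewrite -ler_pdivlMl ?normr_gt0// -normfV.
by rewrite -{1}(scalerK c0 f) opnorm_le_scale.
Qed.

Lemma opnorm_eq0 f : opnorm f = 0 -> f = 0.
Proof.
move=> f0; apply/val_inj/funext => x /=.
have [->|x0] := eqVneq x 0; first exact: bop0.
have : `|f (`|x|^-1 *: x)| <= 0.
  by rewrite -f0 opnorm_ub// normrZ normfV normr_id mulVf// normr_eq0.
rewrite normr_le0 bopZ scaler_eq0 invr_eq0 normr_eq0 (negPf x0) /=.
by move/eqP.
Qed.

HB.instance Definition _ :=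
  Lmodule_isNormed.Build R[i] (bop V) opnormD opnormZ opnorm_eq0.

End OperatorNorm.

Section HilbertOperators.
Context {R : realType} {H : hilbertType R}.
Implicit Types (f : H -> H) (a u v : bop H) (M : set H).

(* Pointwise, the vector z with <f x, y> = <x, z> for all x: unique when it
   exists, and it always exists for a bounded operator f by Riesz's theorem. *)
Definition adjoint f : H -> H := fun y =>
  xget 0 [set z | forall x, inner (f x) y = inner x z].

(* Orthogonal projection onto a closed subspace M. *)
Definition orthogonal_projection M : H -> H := fun x =>
  xget 0 [set y | M y /\ forall z, M z -> inner (x - y) z = 0].

Definition range_projection a := orthogonal_projection (closure (range a)).

Definition normal_operator a := adjoint a \o a = a \o adjoint a.

Definition compact_operator a := precompact (a @` [set x : H | `|x| <= 1]).

Definition unitary u := adjoint u \o u = id /\ u \o adjoint u = id.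

Definition unitary_orbit a : set (bop H) :=
  [set b | exists2 u, unitary u & b = u \o a \o adjoint u :> (H -> H)].

Definition initial_partial_isometries a : set (bop H) :=
  [set v | adjoint v \o v = range_projection a].

End HilbertOperators.

(* Main.v *)
Require Import Defs.
From HB Require Import structures.
From mathcomp Require Import all_boot all_order all_algebra.
From mathcomp Require Import complex.
From mathcomp Require Import all_classical all_reals all_analysis.
From mathcomp Require Import ring lra.

Set Implicit Arguments.
Unset Strict Implicit.
Unset Printing Implicit Defensive.

Import Order.TTheory GRing.Theory Num.Theory.
Import numFieldNormedType.Exports.

Local Open Scope classical_set_scope.
Local Open Scope ring_scope.
Local Open Scope complex_scope.

(** Write a' for the adjoint of [a] and P for its range projection.  Normality
    gives |a' x| = |a x|, so [a] and a' have the same kernel, whence a P = a and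
    the range of a' lies in the closed range of [a].  If v' v = P and
    b = v a v', then v' b v = P a P = a; and b v = v a shows that v maps the
    closed range of [a] onto that of [b], so that v v' is the range projection
    of [b] ([conjugate_recover], [conjugate_final_projection]).

    Such a [b] is a limit of unitary conjugates of [a].  The isometry v on the
    closed range of [a] may have no unitary extension, but for any finitely many
    vectors there some unitary agrees with v on them ([unitary_extension]).  Take
    vectors x_i such that the a x_i are an e-net of the image of the unit
    ball under [a]; since |a' x - a' y| = |a x - a y|, the a' x_i are one for a'.
    A unitary u equal to v at all a x_i and a' x_i makes u a close to v a and
    u a' close to v a' in norm, hence u a u' close to v a v'
    ([conjugate_in_orbit_closure]).

    Conversely let [b] be a limit of conjugates u a u'.  Take an ultrafilter on
    the operators u along which u is unitary and u a u' tends to [b].  For a fixed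
    unitary w of it, u a x = (u a u') (u x) is uniformly close to w a w' (u x),
    which converges along the ultrafilter because [a] is compact and u x is
    bounded; so u a x is Cauchy and converges.  Therefore u converges pointwise on
    the closed range of [a], to an isometry; v is that limit composed with P.  By
    compactness a u' y converges as well, and its limit is a v' y because
    <a u' y, x> = <y, u a' x> tends to <y, v a' x>.  As u is isometric,
    b y = lim u (a u' y) = v a v' y ([limit_conjugate]).

    The tools from Hilbert space geometry are the projection theorem
    ([projection_exists]) and the representation of functionals ([riesz]), from
    which the adjoint gets its defining identity ([adjointP]). *)

(** * Inner products and orthogonal projection *)

(** A modulus of continuity for products: a perturbation of both factors by less
    than d, with factors of size a and b, changes the product by less than e. *)
Lemma product_modulus (C : numFieldType) (e a b : C) :
  0 < e -> 0 <= a -> 0 <= b ->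
  exists2 d, 0 < d & d * b + a * d + d * d < e.
Proof.
move=> e0 a0 b0; set N := 1 + e + a + b.
have N0 : 0 < N by rewrite /N -!addrA ltr_pwDl ?addr_ge0 ?(ltW e0).
exists (e / N); first by rewrite divr_gt0.
rewrite [a * _]mulrC -!mulrDr -mulrA gtr_pMr// mulrC ltr_pdivrMr// mul1r.
rewrite [b + a]addrC.
apply: (@le_lt_trans _ _ (a + b + 1)).
  by rewrite lerD2l ler_pdivrMr// mul1r /N [1 + e]addrC -!addrA lerDl !addr_ge0.
by rewrite addrC /N -!addrA ltrD2l ltrDr.
Qed.

Section InnerProduct.
Context {R : realType} {H : hilbertType R}.
Implicit Types x y z : H.

Lemma innerC x y : inner x y = (inner y x)^*%R.
Proof. by rewrite (hermC (@inner R H)) expr0 mul1r. Qed.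

Lemma innerDl x y z : inner (x + y) z = inner x z + inner y z.
Proof. exact: linearDl. Qed.
Lemma innerBl x y z : inner (x - y) z = inner x z - inner y z.
Proof. exact: linearBl. Qed.
Lemma innerZl c x z : inner (c *: x) z = c * inner x z.
Proof. exact: linearZl_LR. Qed.
Lemma inner0l z : inner 0 z = 0. Proof. exact: linear0l. Qed.
Lemma innerDr x y z : inner z (x + y) = inner z x + inner z y.
Proof. exact: linearDr. Qed.
Lemma innerBr x y z : inner z (x - y) = inner z x - inner z y.
Proof. exact: linearBr. Qed.
Lemma innerZr c x z : inner z (c *: x) = c^*%R * inner z x.
Proof. exact: linearZr_LR. Qed.
Lemma inner0r z : inner z 0 = 0. Proof. exact: linear0r. Qed.

Lemma norm_sqrE x : `|x| ^+ 2 = inner x x.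
Proof. exact: sqr_norm_inner. Qed.

Lemma eq_norm x y : inner x x = inner y y -> `|x| = `|y|.
Proof. by move=> xy; apply/eqP; rewrite -(@eqrXn2 _ 2)// !norm_sqrE xy. Qed.

Lemma inner_self_eq0 x : inner x x = 0 -> x = 0.
Proof. by rewrite -norm_sqrE => /eqP; rewrite expf_eq0/= normr_eq0 => /eqP. Qed.

Lemma inner_ext x y : (forall z, inner x z = inner y z) -> x = y.
Proof.
move=> xy; apply/eqP; rewrite -subr_eq0; apply/eqP/inner_self_eq0.
by rewrite innerBl xy subrr.
Qed.

(** The component of x orthogonal to y; its length controls the inner product
    both in the Cauchy-Schwarz inequality and at a nearest point. *)
Lemma norm_sqr_residual x y : y != 0 ->
  `|x - (inner x y / inner y y) *: y| ^+ 2
  = `|x| ^+ 2 - `|inner x y| ^+ 2 / `|y| ^+ 2.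
Proof.
move=> y0.
have y2 : inner y y != 0 by apply/eqP => /inner_self_eq0/eqP; rewrite (negPf y0).
rewrite !norm_sqrE innerBl !innerBr !innerZl !innerZr /= [X in _ - (_ - X)]mulrCA.
by rewrite divfK// opprB addrA addrNK (innerC y x) mulrAC -normCK.
Qed.

Lemma inner_CauchySchwarz x y : `|inner x y| <= `|x| * `|y|.
Proof.
have [->|y0] := eqVneq y 0; first by rewrite inner0r !normr0 mulr0.
have := exprn_ge0 2 (normr_ge0 (x - (inner x y / inner y y) *: y)).
rewrite norm_sqr_residual// subr_ge0 ler_pdivrMr ?exprn_gt0 ?normr_gt0// -exprMn.
by rewrite ler_sqr ?nnegrE ?mulr_ge0.
Qed.

Lemma near_inner T (F : set_system T) (FF : Filter F) (f g : T -> H) (l m : H)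
    (e : R[i]) :
  f @ F --> l -> g @ F --> m -> 0 < e ->
  \forall t \near F, `|inner l m - inner (f t) (g t)| < e.
Proof.
move=> fl gm e0.
have [d d0 de] := product_modulus e0 (normr_ge0 l) (normr_ge0 m).
move/cvgrPdist_lt : fl => /(_ _ d0) fl; move/cvgrPdist_lt : gm => /(_ _ d0) gm.
near=> t.
have ft : `|l - f t| < d by near: t.
have gt : `|m - g t| < d by near: t.
have -> : inner l m - inner (f t) (g t) =
    inner (l - f t) m + inner l (m - g t) - inner (l - f t) (m - g t).
  rewrite !innerBl !innerBr; ring.
apply: le_lt_trans de.
apply: (le_trans (ler_normB _ _)); apply: lerD.
  apply: (le_trans (ler_normD _ _)); apply: lerD.
    by apply: (le_trans (inner_CauchySchwarz _ _)); rewrite ler_wpM2r// ltW.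
  by apply: (le_trans (inner_CauchySchwarz _ _)); rewrite ler_wpM2l// ltW.
by apply: (le_trans (inner_CauchySchwarz _ _)); rewrite ler_pM// ltW.
Unshelve. all: by end_near. Qed.

(** Identities between inner products pass to the limit.  It is by this lemma
    that the identities satisfied by approximants reach limit vectors. *)
Lemma cvg_inner_eq T (F : set_system T) (FF : ProperFilter F)
    (f g f' g' : T -> H) (l m l' m' : H) :
  f @ F --> l -> g @ F --> m -> f' @ F --> l' -> g' @ F --> m' ->
  (\forall t \near F, inner (f t) (g t) = inner (f' t) (g' t)) ->
  inner l m = inner l' m'.
Proof.
move=> fl gm fl' gm' fgE; apply/eqP; rewrite -subr_eq0 -normr_le0.
apply/ler_addgt0Pr => e e0; rewrite add0r.
have e2 : 0 < e / 2 by rewrite divr_gt0.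
near F => t.
have -> : inner l m - inner l' m' = (inner l m - inner (f t) (g t))
    - (inner l' m' - inner (f' t) (g' t)).
  have -> : inner (f t) (g t) = inner (f' t) (g' t) by near: t.
  by ring.
rewrite (splitr e) (le_trans (ler_normB _ _))// lerD// ltW//; near: t;
  exact: near_inner.
Unshelve. all: by end_near. Qed.

Definition is_subspace (M : set H) :=
  M 0 /\ forall c x y, M x -> M y -> M (c *: x + y).

Lemma parallelogram x y :
  `|x + y| ^+ 2 + `|x - y| ^+ 2 = 2 * `|x| ^+ 2 + 2 * `|y| ^+ 2.
Proof. by rewrite !norm_sqrE innerBl !innerBr innerDl !innerDr; ring. Qed.

Lemma projection_unique (M : set H) x y y' : is_subspace M ->
  M y -> (forall z, M z -> inner (x - y) z = 0) ->
  M y' -> (forall z, M z -> inner (x - y') z = 0) -> y = y'.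
Proof.
move=> [_ Mlin] My yx My' y'x; apply/eqP; rewrite -subr_eq0; apply/eqP.
have Myy' : M (y - y') by rewrite -scaleN1r addrC; apply: Mlin.
apply: inner_self_eq0.
have {1}-> : y - y' = (x - y') - (x - y) by rewrite opprB [RHS]addrC addrA subrK.
by rewrite innerBl yx// y'x// subrr.
Qed.

(** The projection is a nearest point.  By the parallelogram law, two points of
    M almost realising the distance d to x are close to each other, so the sets of
    such points generate a Cauchy filter; at its limit y, moving along z cannot
    bring y closer to x, which forces x - y to be orthogonal to z. *)
Lemma projection_exists (M : set H) x : is_subspace M -> closed M ->
  exists y, M y /\ forall z, M z -> inner (x - y) z = 0.
Proof.
move=> [M0 Mlin] Mcl.
pose nrm (y : H) : R := complex.Re `|y|.
have nrmE y : (nrm y)%:C = `|y| by exact: ReK_norm.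
have nrm0 y : 0 <= nrm y by rewrite -lecR nrmE; exact: normr_ge0.
set D := [set nrm (x - y) | y in M].
have Dinf : has_inf D.
  split; first by exists (nrm (x - 0)), 0.
  by exists 0 => _ [y _ <-].
set d := inf D.
have dle y : M y -> d <= nrm (x - y).
  by move=> My; apply: ge_inf; [exact: Dinf.2|exists y].
have d0 : 0 <= d by apply: lb_le_inf; [exact: Dinf.1|move=> _ [y _ <-]].
pose A (e : R) := M `&` [set y | nrm (x - y) < d + e].
pose F := filter_from [set e : R | 0 < e] A.
have FF : ProperFilter F.
  apply: filter_from_proper; last first.
    by move=> e e0; have [_ [y My <-] ye] := inf_adherent e0 Dinf; exists y.
  apply: filter_from_filter; first by exists 1 => /=.
  move=> e e' /= e0 e'0; exists (Num.min e e'); first by rewrite /= lt_min e0.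
  move=> y [My]; rewrite /= -ltrBlDl lt_min !ltrBlDl => /andP[? ?].
  by split; split.
have par y y' : M y -> M y' ->
    nrm (y - y') ^+ 2 <= 2 * nrm (x - y) ^+ 2 + 2 * nrm (x - y') ^+ 2 - 4 * d ^+ 2.
  move=> My My'.
  have : nrm (x - y + (x - y')) ^+ 2 + nrm (y - y') ^+ 2 =
         2 * nrm (x - y) ^+ 2 + 2 * nrm (x - y') ^+ 2.
    apply: complexI; rewrite !(rmorphD, rmorphM, rmorphXn) /= !nrmE.
    rewrite -parallelogram.
    have -> : y - y' = - ((x - y) - (x - y')) by rewrite !opprB [RHS]addrC addrA subrK.
    by rewrite normrN.
  have Mh : M (2^-1 *: (y + y')).
    rewrite -[_ *: _]addr0; apply: (Mlin) => //.
    by rewrite -[y]scale1r; apply: Mlin.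
  have /(_ _ Mh) := dle.
  have -> : nrm (x - y + (x - y')) = 2 * nrm (x - 2^-1 *: (y + y')).
    apply: complexI; rewrite rmorphM rmorph_nat /= !nrmE.
    have -> : x - y + (x - y') = 2 *: (x - 2^-1 *: (y + y')).
      by rewrite scalerBr scalerA divff// scale1r scaler_nat mulr2n opprD addrACA.
    by rewrite normrZ ger0_norm.
  by nra.
have /cauchy_cvgP/cvg_ex[y Fy] : cauchy F.
  apply/cauchy_exP => e e0.
  have eE : (complex.Re e)%:C = e by rewrite RRe_real// gtr0_real.
  move: e0; rewrite -{}eE ltcR; move: (complex.Re e) => {}e e0.
  (* Within d + t of x, points of M have mutual squared distance at most
     4 (d + t)^2 - 4 d^2 = 4 t (2 d + t), less than t (8 d + 8) when t <= 1. *)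
  pose t := Num.min 1 (e ^+ 2 / (8 * d + 8)).
  have t0 : 0 < t by rewrite lt_min ltr01 divr_gt0 ?exprn_gt0//; lra.
  have t1 : t <= 1 by rewrite ge_min lexx.
  have te : t * (8 * d + 8) <= e ^+ 2.
    by rewrite -ler_pdivlMr ?ge_min ?lexx ?orbT//; lra.
  have [_ [x0 Mx0 <-] x0t] := inf_adherent t0 Dinf.
  exists x0, t => // y [My yt]; rewrite -ball_normE/= -nrmE ltcR.
  rewrite -(@ltr_pXn2r _ 2) ?nnegrE ?(ltW e0) ?nrm0//.
  have := par _ _ Mx0 My; move: (nrm0 (x - x0)) (nrm0 (x - y)) x0t yt => /=.
  rewrite -/d; move: (nrm (x - x0)) (nrm (x - y)) => p q p0 q0 pd qd.
  move=> /le_lt_trans; apply.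
  have dt0 : 0 <= d + t by lra.
  have p2 : p ^+ 2 <= (d + t) ^+ 2 by rewrite ler_pXn2r ?nnegrE// ltW.
  have q2 : q ^+ 2 <= (d + t) ^+ 2 by rewrite ler_pXn2r ?nnegrE// ltW.
  by nra.
have My : M y.
  apply: (@closed_cvg _ _ F _ id M Mcl _ y Fy); exists 1 => //=.
  by move=> z [].
exists y; split => // z Mz.
have dy : nrm (x - y) <= d.
  apply/ler_addgt0Pr => e e0; near F => y'.
  have : `|y - y'| < (e / 2)%:C.
    near: y'; have e2 : 0 < (e / 2)%:C by rewrite ltcR divr_gt0.
    by have := Fy _ (nbhsx_ballx y _ e2); rewrite -ball_normE.
  have : nrm (x - y') < d + e / 2.
    by near: y'; exists (e / 2) => [|? []//]; rewrite /= divr_gt0.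
  have : nrm (x - y) <= nrm (x - y') + nrm (y - y').
    rewrite -lecR rmorphD /= !nrmE.
    have -> : x - y = (x - y') - (y - y') by rewrite opprB addrA subrK.
    exact: ler_normB.
  rewrite -nrmE ltcR; lra.
have [->|z0] := eqVneq z 0; first exact: inner0r.
have Mw : M (inner (x - y) z / inner z z *: z + y) by exact: Mlin.
have := le_trans dy (dle _ Mw); rewrite -lecR !nrmE opprD addrA addrAC.
rewrite -ler_sqr ?nnegrE// norm_sqr_residual// lerDl oppr_ge0.
rewrite pmulr_lle0 ?invr_gt0 ?exprn_gt0 ?normr_gt0//.
by rewrite real_exprn_even_le0 //= normr_eq0 => /eqP.
Unshelve. all: by end_near. Qed.

End InnerProduct.

(** * Bounded operators, adjoints and range projections *)

Section Operators.
Context {R : realType} {H : hilbertType R}.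
Implicit Types (x y z : H) (f g a b u v : bop H) (M : set H).

Lemma bop_bound f : exists2 C : R[i], 0 < C & forall x, `|f x| <= C * `|x|.
Proof.
have /asboolP[_ [C fC]] := bop_funP f.
exists (`|C| + 1)%:C; first by rewrite (ltcR 0) ltr_wpDl.
move=> x; apply: (le_trans (fC x)); rewrite ler_wpM2r// lecR.
by rewrite ler_wpDr// ler_norm.
Qed.

Lemma bopP f c x y : f (c *: x + y) = c *: f x + f y.
Proof. by have /asboolP[+ _] := bop_funP f; apply. Qed.

Lemma bopB f x y : f (x - y) = f x - f y.
Proof. by rewrite addrC -scaleN1r bopP scaleN1r addrC. Qed.

Lemma bounded_operatorI (f : H -> H) (C : R[i]) : linear f ->
  (forall x, `|f x| <= C * `|x|) -> f \in bounded_operator.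
Proof.
move=> lf fC; apply/asboolP; split=> //; exists (complex.Re `|C|) => x.
rewrite (RRe_real (normr_real C)).
rewrite (le_trans (fC x))// -[leLHS]ger0_norm ?(le_trans _ (fC x))//.
by rewrite normrM normr_id.
Qed.

Lemma cvg_bop f T (F : set_system T) (FF : Filter F) (h : T -> H) l :
  h @ F --> l -> f \o h @ F --> f l.
Proof.
move=> hl; have [C C0 fC] := bop_bound f.
apply/cvgrPdist_lt => e e0; near=> t.
rewrite /= -bopB (le_lt_trans (fC _))// -ltr_pdivlMl//.
near: t; move/cvgrPdist_lt : hl; apply; rewrite mulr_gt0 ?invr_gt0//.
Unshelve. all: by end_near. Qed.

Lemma closure_filter M x : closure M x ->
  exists F, [/\ ProperFilter F, F --> x & F M].
Proof.
by rewrite closureEcvg => -[F FF [Fx MF]]; exists F; split=> //; exact: MF.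
Qed.

Lemma subspace_closure M : is_subspace M -> is_subspace (closure M).
Proof.
move=> [M0 Mlin]; split; first exact: subset_closure.
move=> c x y /closure_filter[F [FF Fx MF]] /closure_filter[G [GF Gy MG]].
have hl : c *: p.1 + p.2 @[p --> (F, G)] --> c *: x + y.
  apply: cvgD; last exact: cvg_trans (cvg_snd) Gy.
  by apply: cvgZl_tmp; exact: cvg_trans (cvg_fst) Fx.
apply: (closed_cvg _ (@closed_closure _ M) _ _ hl).
exists (M, M) => [|[p q] [/= Mp Mq]]; first by [].
by apply: subset_closure; exact: Mlin.
Qed.

Lemma orthogonal_closure M x : (forall z, M z -> inner x z = 0) ->
  forall z, closure M z -> inner x z = 0.
Proof.
move=> xM z /closure_filter[F [FF Fz MF]].
have -> : 0 = inner x 0 :> R[i] by rewrite inner0r.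
apply: (@cvg_inner_eq _ _ _ F FF (cst x) id (cst x) (cst 0)) => //; try exact: cvg_cst.
by apply: filterS MF => t Mt /=; rewrite inner0r xM.
Qed.

(** The kernel N of x |-> <f x, y> is closed; if it is not everything, a vector
    e orthogonal to N represents the functional up to a factor, since
    phi(e) x - phi(x) e lies in N. *)
Lemma riesz f y : exists z, forall x, inner (f x) y = inner x z.
Proof.
pose N := [set x | inner (f x) y = 0].
have Nsub : is_subspace N.
  split=> [|c x x']; first by rewrite /N /= bop0 inner0l.
  by rewrite /N /= bopP innerDl innerZl => -> ->; rewrite mulr0 addr0.
have Ncl : closed N.
  move=> x /closure_filter[F [FF Fx NF]]; rewrite /N /=.
  have -> : 0 = inner x 0 :> R[i] by rewrite inner0r.
  apply: (@cvg_inner_eq _ _ _ F FF (f \o id) (cst y) id (cst 0)) => //; try exact: cvg_cst.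
    exact: cvg_bop.
  by apply: filterS NF => t Nt /=; rewrite inner0r Nt.
have [fy0|] := pselect (forall x, inner (f x) y = 0).
  by exists 0 => x; rewrite inner0r fy0.
move=> /existsNP[x0 /eqP fx0].
have [p [Np px0]] := projection_exists x0 Nsub Ncl.
pose e := x0 - p; pose k := inner (f e) y.
have kE : k = inner (f x0) y by rewrite /k /e bopB innerBl Np subr0.
have e0 : inner e e != 0.
  apply: contraNneq fx0 => /inner_self_eq0 e0.
  by rewrite -kE /k e0 bop0 inner0l.
exists ((k / inner e e)^*%R *: e) => x; rewrite innerZr conjCK.
have : inner (k *: x - inner (f x) y *: e) e = 0.
  rewrite innerC px0 ?conjC0// /N /= bopB !bopZ innerBl !innerZl -/k.
  by rewrite mulrC subrr.
rewrite innerBl !innerZl => /eqP; rewrite subr_eq0 => /eqP kx.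
by rewrite mulrAC kx mulfK.
Qed.

Lemma adjointP f x y : inner (f x) y = inner x (adjoint f y).
Proof. by move: x; apply: (xgetPex 0 (riesz f y)). Qed.

Lemma adjointPl f x y : inner (adjoint f x) y = inner x (f y).
Proof. by rewrite innerC -adjointP -innerC. Qed.

Lemma adjoint_uniq f (g : H -> H) :
  (forall x y, inner (f x) y = inner x (g y)) -> adjoint f = g.
Proof.
move=> fg; apply/funext => y; apply: inner_ext => z.
by rewrite adjointPl innerC fg -innerC.
Qed.

Lemma adjoint_bounded f : adjoint f \in bounded_operator.
Proof.
have [C C0 fC] := bop_bound f; apply: (@bounded_operatorI _ C) => [c x y|x].
  apply: inner_ext => z.
  by rewrite adjointPl !innerDl !innerZl !adjointPl.
have [->|x0] := eqVneq (adjoint f x) 0; first by rewrite normr0 mulr_ge0// ltW.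
rewrite -(@ler_pM2r _ `|adjoint f x|) ?normr_gt0// -expr2.
rewrite -[leLHS]ger0_norm ?exprn_ge0// norm_sqrE adjointPl.
rewrite (le_trans (inner_CauchySchwarz _ _))// [C * _]mulrC -mulrA.
by rewrite ler_wpM2l.
Qed.

Definition adj f : bop H := Bop (adjoint_bounded f).

Lemma comp_bounded f g : f \o g \in bounded_operator.
Proof.
have [C C0 fC] := bop_bound f; have [D D0 gD] := bop_bound g.
apply: (@bounded_operatorI _ (C * D)) => [c x y|x]; first by rewrite /= !bopP.
by rewrite (le_trans (fC _))// -mulrA ler_wpM2l// ltW.
Qed.

Definition bcomp f g : bop H := Bop (comp_bounded f g).

Lemma bop_opnorm f x : `|f x| <= opnorm f * `|x|.
Proof.
have [->|x0] := eqVneq x 0; first by rewrite bop0 !normr0 mulr0.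
have : `|f (`|x|^-1 *: x)| <= opnorm f.
  by rewrite opnorm_ub// normrZ normfV normr_id mulVf// normr_eq0.
by rewrite bopZ normrZ normfV normr_id mulrC ler_pdivrMr ?normr_gt0.
Qed.

(** Norm approximation of operators, by real tolerances and without the
    supremum that defines the operator norm. *)
Lemma closure_bopP (S : set (bop H)) b : closure S b <->
  forall e : R, 0 < e -> exists2 c, S c & forall x, `|b x - c x| <= e%:C * `|x|.
Proof.
split=> [Sb e e0|Sb B].
  have e0C : 0 < e%:C by rewrite ltcR.
  have [c [Sc]] := Sb _ (nbhsx_ballx b _ e0C).
  rewrite -ball_normE/= => bc; exists c => // x.
  have /= := bop_opnorm (b - c) x => /le_trans; apply.
  by rewrite ler_wpM2r// ltW.
move=> /nbhs_ballP[e /= e0 eB].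
have eE : (complex.Re e)%:C = e by rewrite RRe_real// gtr0_real.
move: e0 eB; rewrite -{}eE; move: (complex.Re e) => {}e; rewrite ltcR => e0 eB.
have e2 : 0 < e / 2 by rewrite divr_gt0.
have [c Sc bc] := Sb _ e2; exists c; split=> //; apply: eB.
rewrite -ball_normE/=; apply: (@le_lt_trans _ _ (e / 2)%:C).
  apply: opnorm_le => x x1; rewrite (le_trans (bc x))// ler_piMr//.
  by rewrite lecR ltW.
by rewrite ltcR ltr_pdivrMr// mulr_natr mulr2n ltrDl.
Qed.

Lemma range_subspace a : is_subspace (range a).
Proof.
split; first by exists 0 => //; rewrite bop0.
by move=> c _ _ [x _ <-] [y _ <-]; exists (c *: x + y) => //; rewrite bopP.
Qed.

Lemma range_projectionP a x : closure (range a) (range_projection a x) /\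
  forall z, closure (range a) z -> inner (x - range_projection a x) z = 0.
Proof.
have sub := subspace_closure (range_subspace a).
exact: (xgetPex 0 (projection_exists x sub (@closed_closure _ _))).
Qed.

Lemma range_projection_uniq a x y : closure (range a) y ->
  (forall z, inner (x - y) (a z) = 0) -> range_projection a x = y.
Proof.
move=> ya xy; have [pa xp] := range_projectionP a x.
apply: (projection_unique (subspace_closure (range_subspace a)) pa xp ya).
by apply: orthogonal_closure => _ [z _ <-].
Qed.

Lemma range_projection_id a y : closure (range a) y -> range_projection a y = y.
Proof.
by move=> ya; apply: range_projection_uniq => // z; rewrite subrr inner0l.
Qed.

Lemma range_projection_range a x : range_projection a (a x) = a x.
Proof. by apply: range_projection_id; apply: subset_closure; exists x. Qed.

Lemma range_projection_linear a : linear (range_projection a).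
Proof.
move=> c x y; have [xa xp] := range_projectionP a x.
have [ya yp] := range_projectionP a y.
apply: range_projection_uniq.
  by apply: (subspace_closure (range_subspace a)).2.
move=> z; have az : closure (range a) (a z) by apply: subset_closure; exists z.
rewrite opprD addrACA -scalerBr innerDl innerZl xp// yp//.
by rewrite mulr0 addr0.
Qed.

Lemma range_projection_inner a x y :
  inner (range_projection a x) y
  = inner (range_projection a x) (range_projection a y).
Proof.
have [xa _] := range_projectionP a x; have [_ yp] := range_projectionP a y.
by apply/eqP; rewrite -subr_eq0 -innerBr innerC yp// conjC0.
Qed.

Lemma range_projection_le a x : `|range_projection a x| <= `|x|.
Proof.
have [->|x0] := eqVneq (range_projection a x) 0; first by rewrite normr0.
rewrite -(@ler_pM2l _ `|range_projection a x|) ?normr_gt0// -expr2.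
rewrite -[leLHS]ger0_norm ?exprn_ge0// norm_sqrE -range_projection_inner.
exact: inner_CauchySchwarz.
Qed.

Lemma normal_norm a : normal_operator a -> forall x, `|adjoint a x| = `|a x|.
Proof.
move=> na x; apply: eq_norm; rewrite -adjointP -(adjointPl a (a x)).
by have /= := congr1 (fun h => h x) na => ->.
Qed.

(** A vector orthogonal to the range of [a] is in the kernel of its adjoint, which
    normality identifies with that of [a]. *)
Lemma normal_ker a x : normal_operator a ->
  (forall z, inner x (a z) = 0) -> a x = 0.
Proof.
move=> na xa; apply/eqP; rewrite -normr_eq0 -normal_norm// normr_eq0; apply/eqP.
by apply: inner_self_eq0; rewrite adjointPl xa.
Qed.

Lemma normal_range_projection a x : normal_operator a ->
  a (range_projection a x) = a x.
Proof.
move=> na; apply/esym/eqP; rewrite -subr_eq0 -bopB; apply/eqP/normal_ker => // z.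
by apply: (range_projectionP a x).2; apply: subset_closure; exists z.
Qed.

(** The part z of a' x orthogonal to the range of [a] satisfies a z = 0, so
    <z, z> = <a' x, z> = <x, a z> = 0. *)
Lemma normal_adjoint_range a x : normal_operator a ->
  closure (range a) (adjoint a x).
Proof.
move=> na; set y := adjoint a x; have [pa yp] := range_projectionP a y.
suff : y - range_projection a y = 0 by move/eqP; rewrite subr_eq0 => /eqP ->.
have az : a (y - range_projection a y) = 0.
  by rewrite bopB normal_range_projection// subrr.
apply: inner_self_eq0; rewrite innerBr (yp _ pa) subr0 /y innerC adjointPl az.
by rewrite inner0r conjC0.
Qed.

Section PartialIsometry.
Variables (a v : bop H).
Hypothesis va : initial_partial_isometries a v.

Lemma partial_isometryE x : adjoint v (v x) = range_projection a x.
Proof. by have /= := congr1 (fun h => h x) va. Qed.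

Lemma partial_isometry_inner x y :
  inner (v x) (v y) = inner (range_projection a x) (range_projection a y).
Proof. by rewrite -range_projection_inner -partial_isometryE adjointPl. Qed.

Lemma partial_isometry_norm x : `|v x| = `|range_projection a x|.
Proof.
by apply: eq_norm; rewrite partial_isometry_inner.
Qed.

(** v vanishes on the orthogonal complement of its initial space. *)
Lemma partial_isometry_projection x : v (range_projection a x) = v x.
Proof.
apply/esym/eqP; rewrite -subr_eq0 -bopB -normr_eq0 partial_isometry_norm.
rewrite normr_eq0; apply/eqP/range_projection_uniq.
  exact: (subspace_closure (range_subspace a)).1.
move=> z; rewrite subr0; apply: (range_projectionP a x).2.
by apply: subset_closure; exists z.
Qed.

End PartialIsometry.

Lemma conjugate_recover a b v : normal_operator a ->
  initial_partial_isometries a v ->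
  b = v \o a \o adjoint v :> (H -> H) -> a = adjoint v \o b \o v :> (H -> H).
Proof.
move=> na va bE; rewrite bE; apply/funext => x /=.
rewrite !(partial_isometryE va) range_projection_range.
by rewrite normal_range_projection.
Qed.

(** v v' y is v applied to a limit of vectors a x, and v (a x) = b (v x); the rest
    y - v v' y is orthogonal to v (a x) because v' maps it to the part of v' y that
    is orthogonal to the range of [a]. *)
Lemma conjugate_final_projection a b v : normal_operator a ->
  initial_partial_isometries a v -> b = v \o a \o adjoint v :> (H -> H) ->
  v \o adjoint v = range_projection b.
Proof.
move=> na va bE; apply/funext => y /=; apply/esym/range_projection_uniq.
  rewrite -(partial_isometry_projection va).
  have [/closure_filter[F [FF Fz Fa]] _] := range_projectionP a (adjoint v y).
  have cv := @cvg_bop v _ F FF id _ Fz.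
  apply: (@closed_cvg _ _ F FF _ (closure (range b)) (@closed_closure _ _) _ _ cv).
  apply: filterS Fa => _ [x _ <-]; apply: subset_closure; exists (v x) => //.
  by rewrite bE /= (partial_isometryE va) normal_range_projection.
move=> z; rewrite bE /= -adjointPl -[adjoint v]/(adj v : H -> H) bopB /=.
rewrite (partial_isometryE va); apply: (range_projectionP a _).2.
by apply: subset_closure; exists (adjoint v z).
Qed.

End Operators.
Arguments cvg_bop {R H} f {T F FF h l}.

(** * Unitaries with prescribed values on finitely many vectors *)

Section Backward.
Context {R : realType} {H : hilbertType R}.
Implicit Types (x y z d : H) (f g a b u v : bop H) (M : set H).

Lemma unitaryK u : unitary u -> cancel u (adjoint u).
Proof. by move=> [u1 _] x; have /= -> := congr1 (fun h => h x) u1. Qed.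

Lemma unitaryVK u : unitary u -> cancel (adjoint u) u.
Proof. by move=> [_ u1] x; have /= -> := congr1 (fun h => h x) u1. Qed.

Lemma unitary_inner u x y : unitary u -> inner (u x) (u y) = inner x y.
Proof.
by move=> uu; rewrite adjointP unitaryK.
Qed.

Lemma unitary_norm u x : unitary u -> `|u x| = `|x|.
Proof.
by move=> uu; apply: eq_norm; rewrite unitary_inner.
Qed.

Lemma unitary_norm_adj u x : unitary u -> `|adjoint u x| = `|x|.
Proof. by move=> uu; rewrite -(unitary_norm _ uu) unitaryVK. Qed.

Lemma unitaryI f g : (forall x y, inner (f x) y = inner x (g y)) ->
  cancel f g -> cancel g f -> unitary f.
Proof.
move=> fg fgK gfK; rewrite /unitary (adjoint_uniq fg).
by split; apply/funext => x /=; rewrite ?fgK ?gfK.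
Qed.

Lemma unitary_comp f g : unitary f -> unitary g -> unitary (bcomp f g).
Proof.
move=> uf ug; apply: (@unitaryI _ (bcomp (adj g) (adj f))).
- by move=> x y /=; rewrite !adjointP.
- by move=> x /=; rewrite !unitaryK.
- by move=> x /=; rewrite !unitaryVK.
Qed.

Lemma bounded_id : id \in @bounded_operator R H.
Proof. by apply: (@bounded_operatorI _ _ _ 1) => // x; rewrite mul1r. Qed.

Definition bop_id : bop H := Bop bounded_id.

Lemma unitary_id : unitary bop_id.
Proof. exact: (@unitaryI _ bop_id). Qed.

(** For real k = |d|^2 / 2 this is the reflection in the hyperplane orthogonal to
    d; a complex k allows another unit factor than -1 on the line spanned by d. *)
Definition householder (k : R[i]) d x := x - (inner x d / k) *: d.

Lemma householder_bounded k d : householder k d \in bounded_operator.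
Proof.
apply: (@bounded_operatorI _ _ _ (1 + `|d| ^+ 2 / `|k|)) => [c x y|x].
  rewrite /householder innerDl innerZl mulrDl scalerDl opprD addrACA.
  by rewrite scalerBr scalerA mulrA.
rewrite (le_trans (ler_normB _ _))// mulrDl mul1r lerD2l normrZ normf_div.
have -> : `|d| ^+ 2 / `|k| * `|x| = `|x| * `|d| / `|k| * `|d| by ring.
by rewrite !ler_wpM2r// ?invr_ge0// inner_CauchySchwarz.
Qed.

Definition householder_bop k d : bop H := Bop (householder_bounded k d).

(** The hypothesis on k makes 1 - |d|^2 / k = - conj k / k, so that d is multiplied
    by a scalar of modulus 1. *)
Lemma householderK (k : R[i]) d : k != 0 -> k + k^*%R = inner d d ->
  cancel (householder k d) (householder k^*%R d).
Proof.
move=> k0 kd x; have k'0 : k^*%R != 0 by rewrite conjC_eq0.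
rewrite /householder innerBl innerZl -kd -addrA -opprD -scalerDl.
set s := inner x d.
suff -> : s / k + (s - s / k * (k + k^*%R)) / k^*%R = 0 by rewrite scale0r subr0.
by move: (k^*%R) k'0 => l l0; field; rewrite l0 k0.
Qed.

Lemma householder_inner (k : R[i]) d x y :
  inner (householder k d x) y = inner x (householder k^*%R d y).
Proof.
rewrite /householder innerBl innerBr innerZl innerZr fmorph_div /= conjCK.
by rewrite -innerC; congr (_ - _); ring.
Qed.

Lemma unitary_householder (k : R[i]) d : k != 0 -> k + k^*%R = inner d d ->
  unitary (householder_bop k d).
Proof.
move=> k0 kd; apply: (@unitaryI _ (householder_bop k^*%R d)).
- exact: householder_inner.
- exact: householderK.
- move=> x; rewrite -{1}[k]conjCK; apply: householderK; first by rewrite conjC_eq0.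
  by rewrite conjCK addrC.
Qed.

(** With d = x - y, the choice k = <x, d> sends x to x - d = y, and |x| = |y|
    makes k + conj k = |d|^2.  If k = 0 then d = 0. *)
Lemma unitary_swap x y : `|x| = `|y| -> exists2 w : bop H, unitary w &
  w x = y /\ forall z, inner z (x - y) = 0 -> w z = z.
Proof.
move=> xy; set d := x - y; have [d0|d0] := eqVneq d 0.
  exists bop_id; first exact: unitary_id.
  by split=> //=; apply/eqP; rewrite -subr_eq0 -/d d0.
have xxyy : inner y y = inner x x by rewrite -!norm_sqrE xy.
pose k := inner x d.
have kd : k + k^*%R = inner d d.
  rewrite /k -innerC /d !innerBr !innerBl xxyy; ring.
have k0 : k != 0.
  by apply: contraNneq d0 => k0; apply/eqP/inner_self_eq0; rewrite -kd k0 conjC0 addr0.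
exists (householder_bop k d); first exact: unitary_householder.
split=> [|z zd]; rewrite /= /householder; last by rewrite zd mul0r scale0r subr0.
by rewrite -/k divff// scale1r /d opprB addrC subrK.
Qed.

(** Induction on the list: a unitary u already correct on s is followed by one
    taking u x to y.  The latter fixes the images of the earlier vectors, because
    equality of the Gram matrices makes them orthogonal to u x - y. *)
Lemma unitary_extension (s : seq (H * H)) :
  {in s &, forall p q, inner p.1 q.1 = inner p.2 q.2} ->
  exists2 u : bop H, unitary u & {in s, forall p, u p.1 = p.2}.
Proof.
elim: s => [_|[x y] s IHs gram]; first by exists bop_id => //; exact: unitary_id.
have [p q ps qs|u uu us] := IHs.
  by apply: gram; rewrite inE ?ps ?qs orbT.
have [|w wu [wx wz]] := @unitary_swap (u x) y.
  apply: eq_norm; rewrite unitary_inner//.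
  by rewrite (gram (x, y) (x, y)) ?mem_head.
exists (bcomp w u); first exact: unitary_comp.
move=> p; rewrite inE => /predU1P[->//|ps] /=.
rewrite wz us// innerBr -{1}(us _ ps) unitary_inner//.
by rewrite (gram p (x, y)) ?subrr ?mem_head// inE ps orbT.
Qed.

Lemma compact_net a : compact_operator a -> forall e : R, 0 < e ->
  exists s : seq H, forall x, `|x| <= 1 ->
    exists2 y, y \in s & `|a x - a y| <= e%:C.
Proof.
rewrite /compact_operator precompactE compact_cover => ac e e0.
have e0C : 0 < e%:C by rewrite ltcR.
have [||s _ scov] := ac H [set x | `|x| <= 1] (fun y => ball (a y) e%:C).
- by move=> y _; exact: ball_open.
- move=> z az; have [_ [[y /= y1 <-]]] := az _ (nbhsx_ballx z _ e0C).
  by move=> /ball_sym zy; exists y.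
exists (finmap.enum_fset s) => x x1.
have /scov[y /= ys] : closure (a @` [set x : H | `|x| <= 1]) (a x).
  by apply: subset_closure; exists x.
by rewrite -ball_normE/= distrC => /ltW ?; exists y.
Qed.

(** The unitary u agrees with v on e/4-nets of the images of the unit ball under
    [a] and its adjoint, so that |v a - u a| and |v a' - u a'| are at most e/2.  Then
    v a v' - u a u' = v a (v' - u') + (v a - u a) u', and the norm of a (v' - u') is
    that of its adjoint (v - u) a'. *)
Lemma conjugate_in_orbit_closure a b v : compact_operator a ->
  normal_operator a -> initial_partial_isometries a v ->
  b = v \o a \o adjoint v :> (H -> H) -> closure (unitary_orbit a) b.
Proof.
move=> ca na va bE; apply/closure_bopP => e e0.
have e4 : 0 < e / 4 by rewrite divr_gt0.
have [s sP] := compact_net ca e4.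
pose t := [seq (a x, v (a x)) | x <- s] ++ [seq (adjoint a x, v (adjoint a x)) | x <- s].
have tP p : p \in t -> closure (range a) p.1 /\ p.2 = v p.1.
  rewrite mem_cat => /orP[] /mapP[x _ ->] /=; split=> //.
    by apply: subset_closure; exists x.
  exact: normal_adjoint_range.
have [p q /tP[p1 ->] /tP[q1 ->]|u uu ut] := @unitary_extension t.
  by rewrite (partial_isometry_inner va) !range_projection_id.
have vle x : `|v x| <= `|x|.
  by rewrite (partial_isometry_norm va) range_projection_le.
have close (T : bop H) : {in s, forall x, u (T x) = v (T x)} ->
    (forall x y, `|T x - T y| = `|a x - a y|) ->
    forall x, `|v (T x) - u (T x)| <= (e / 2)%:C * `|x|.
  move=> Tt Ta x; have /le_trans := bop_opnorm (bcomp (v - u) T) x; apply.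
  rewrite ler_wpM2r//; apply: opnorm_le => {}x x1.
  have [y ys xy] := sP _ x1; change (`|v (T x) - u (T x)| <= (e / 2)%:C).
  have -> : v (T x) - u (T x) = v (T x - T y) - u (T x - T y).
    by rewrite !bopB (Tt _ ys) opprB addrA subrK.
  have -> : (e / 2)%:C = (e / 4)%:C + (e / 4)%:C by rewrite -rmorphD; congr _%:C; lra.
  rewrite (le_trans (ler_normB _ _))// lerD//.
    by rewrite (le_trans (vle _))// Ta.
  by rewrite unitary_norm// Ta.
have aclose := close a.
have a'close := close (adj a).
exists (bcomp (bcomp u a) (adj u)); first by exists u.
move=> x; rewrite bE /=.
have -> : v (a (adjoint v x)) - u (a (adjoint u x)) =
  v (a (adjoint v x - adjoint u x)) + (v (a (adjoint u x)) - u (a (adjoint u x))).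
  by rewrite !bopB addrA subrK.
have -> : e%:C = (e / 2)%:C + (e / 2)%:C by rewrite -rmorphD; congr _%:C; lra.
rewrite mulrDl (le_trans (ler_normD _ _))// lerD//; last first.
  rewrite -(unitary_norm_adj x uu); apply: aclose => // z zs; rewrite (ut (a z, v (a z)))//.
  by rewrite mem_cat map_f.
(* w = a (v' x - u' x), bounded through <w, w> = <x, (v - u) a' w>. *)
apply: le_trans (vle _) _; set w := a _.
have [->|w0] := eqVneq w 0; first by rewrite normr0 mulr_ge0// (lecR 0) ltW ?divr_gt0.
rewrite -(@ler_pM2r _ `|w|) ?normr_gt0// -expr2.
rewrite -[leLHS]ger0_norm ?exprn_ge0// norm_sqrE {1}/w adjointP.
have -> : inner (adjoint v x - adjoint u x) (adjoint a w)
    = inner x (v (adjoint a w) - u (adjoint a w)).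
  by rewrite innerBl innerBr !adjointPl.
rewrite (le_trans (inner_CauchySchwarz _ _))// [_ * `|x|]mulrC -mulrA ler_wpM2l//.
apply: a'close => [z zs|x1 y] /=.
  rewrite (ut (adjoint a z, v (adjoint a z)))//.
  by rewrite mem_cat [X in _ || X]map_f ?orbT.
by rewrite -!(bopB (adj a)) -bopB /= normal_norm.
Qed.
End Backward.

(** * Limits of unitary conjugates along an ultrafilter *)

Lemma ultra_map S T (f : S -> T) (U : set_system S) :
  UltraFilter U -> UltraFilter (f @ U).
Proof.
move=> UU; split=> [|G GG UG]; first exact: fmap_proper_filter.
apply/seteqP; split=> // A GA; case: (in_ultra_setVsetC (f @^-1` A) UU) => // UnA.
have GnA : G (~` A) by apply: UG.
by case: (@filter_not_empty _ G _); rewrite -(setICr A); exact: filterI.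
Qed.

Section Forward.
Context {R : realType} {H : hilbertType R}.
Implicit Types (x y z d : H) (f g a b u v : bop H) (M : set H).

(** Compactness in the form used below: along an ultrafilter, a compact operator
    turns bounded families into convergent ones. *)
Lemma compact_ultra_cvg a T (U : set_system T) (UU : UltraFilter U) (h : T -> H)
    (C : R[i]) : compact_operator a -> 0 < C ->
  (\forall t \near U, `|h t| <= C) -> cvg (a (h t) @[t --> U]).
Proof.
rewrite /compact_operator precompactE compact_ultra => ca C0 hC.
pose k t := a (C^-1 *: h t).
have UP : ProperFilter U := ultra_proper.
have [|l [_ kl]] := ca _ (ultra_map k UU).
  apply: filterS hC => t ht; apply: subset_closure; exists (C^-1 *: h t) => //=.
  by rewrite normrZ normfV gtr0_norm// ler_pdivrMl// mulr1.
apply/cvg_ex; exists (C *: l).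
have -> : (fun t => a (h t)) = (fun t => C *: k t).
  by apply/funext => t; rewrite /k bopZ scalerA divff ?scale1r// gt_eqF.
by apply: cvgZl_tmp.
Qed.

Lemma small_multiple x (e : R[i]) : 0 < e ->
  exists2 r : R, 0 < r & r%:C * `|x| < e.
Proof.
move=> e0; have eE : (complex.Re e)%:C = e by rewrite RRe_real// gtr0_real.
rewrite -(ReK_norm x).
have x0 : 0 <= complex.Re `|x| by rewrite -lecR ReK_norm; exact: normr_ge0.
move: (complex.Re `|x|) x0 e0 => q q0; rewrite -{}eE; move: (complex.Re e) => t.
rewrite ltcR => t0; exists (t / (q + 1)); first by rewrite divr_gt0// ltr_wpDl.
rewrite -rmorphM ltcR mulrAC ltr_pdivrMr ?ltr_wpDl//.
by rewrite ltr_pM2l// ltrDl.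
Qed.

Section Limit.
Variables (a b : bop H) (U : set_system (bop H)).
Hypotheses (ca : compact_operator a) (na : normal_operator a).
Hypothesis UU : UltraFilter U.
Hypothesis Uu : U unitary.
Hypothesis Ub : forall e : R, 0 < e ->
  U [set u : bop H | forall x, `|b x - u (a (adjoint u x))| <= e%:C * `|x|].

Let UP : ProperFilter U := ultra_proper.

(** u (a x) is close to b (u x) along U, and b is close to w a w' for one fixed
    unitary w; compactness makes w (a (w' (u x))) converge. *)
Lemma cvg_range x : cvg ((fun u : bop H => u (a x)) @ U).
Proof.
apply/cauchy_cvgP/cauchy_exP => e e0.
have e4 : 0 < e / 2 / 2 by rewrite !divr_gt0.
have [r r0 rx] := small_multiple x e4.
have [w [wu /= wb]] := filter_ex (filterI Uu (Ub r0)).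
have : cvg ((fun u : bop H => a (adjoint w (u x))) @ U).
  apply: (@compact_ultra_cvg a _ U UU _ (1 + `|x|)) => //.
  by apply: filterS Uu => u uu; rewrite unitary_norm_adj// unitary_norm// lerDr.
move=> /cvg_ex[l /(cvg_bop w) wl]; exists (w l).
have e2 : 0 < e / 2 by rewrite divr_gt0.
move/cvgrPdist_lt : wl => /(_ _ e2) wl.
near=> u; rewrite /= -ball_normE /=.
have uu : unitary u by near: u.
have ub z : `|b z - u (a (adjoint u z))| <= r%:C * `|z|.
  by move: z; near: u; exact: Ub.
(* b (u x) is inserted between u (a x) and w (a (w' (u x))). *)
have -> : w l - u (a x) = (w l - w (a (adjoint w (u x))))
   + ((b (u x) - u (a (adjoint u (u x)))) - (b (u x) - w (a (adjoint w (u x))))).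
  rewrite unitaryK// opprB [X in _ = _ + X]addrC [X in _ = _ + X]addrA.
  by rewrite subrK addrA subrK.
rewrite (splitr e) (le_lt_trans (ler_normD _ _))// ltrD//; first by near: u.
rewrite (splitr (e / 2)).
rewrite (le_lt_trans (ler_normB _ _))// ltrD// (le_lt_trans _ rx)//.
  by rewrite (le_trans (ub _))// unitary_norm.
by rewrite (le_trans (wb _))// unitary_norm.
Unshelve. all: by end_near. Qed.

(** The operators u are isometric, so convergence extends to the closure. *)
Lemma cvg_closure_range y : closure (range a) y ->
  cvg ((fun u : bop H => u y) @ U).
Proof.
move=> /closure_filter[F [FF Fy Fa]].
apply/cauchy_cvgP/cauchy_exP => e e0.
have e2 : 0 < e / 2 by rewrite divr_gt0.
have [y' [yx [x _ xy]]] := filter_ex (filterI (Fy _ (nbhsx_ballx y _ e2)) Fa).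
move: yx; rewrite -xy -ball_normE /= => yx.
have /cvg_ex[l ul] := @cvg_range x; exists l.
move/cvgrPdist_lt : ul => /(_ _ e2) ul.
near=> u; rewrite /=.
have uu : unitary u by near: u.
have -> : l - u y = (l - u (a x)) - u (y - a x) by rewrite bopB opprB addrA subrK.
rewrite (splitr e) (le_lt_trans (ler_normB _ _))// ltrD//; first by near: u.
by rewrite unitary_norm.
Unshelve. all: by end_near. Qed.

(** The projection comes first because u y need only converge for y in the closed
    range of [a]. *)
Definition ultralimit x : H := lim ((fun u : bop H => u (range_projection a x)) @ U).

Lemma ultralimitP x : (fun u : bop H => u (range_projection a x)) @ U --> ultralimit x.
Proof. exact: cvg_closure_range (range_projectionP a x).1. Qed.

Lemma ultralimit_inner x y :
  inner (ultralimit x) (ultralimit y) = inner (range_projection a x) (range_projection a y).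
Proof.
apply: (@cvg_inner_eq _ _ _ U UP _ _ (cst (range_projection a x))
  (cst (range_projection a y)) _ _ _ _ (@ultralimitP x) (@ultralimitP y));
  try exact: cvg_cst.
by apply: filterS Uu => u uu /=; rewrite unitary_inner.
Qed.

Lemma ultralimit_linear : linear ultralimit.
Proof.
move=> c x y.
apply: (cvg_unique (@norm_hausdorff _ _) (@ultralimitP (c *: x + y))).
have -> : (fun u : bop H => u (range_projection a (c *: x + y))) =
  (fun u : bop H => c *: u (range_projection a x) + u (range_projection a y)).
  by apply/funext => u; rewrite range_projection_linear bopP.
by apply: cvgD (@ultralimitP y); apply: cvgZl_tmp; exact: @ultralimitP.
Qed.

Lemma ultralimit_bounded : ultralimit \in bounded_operator.
Proof.
apply: (@bounded_operatorI _ _ _ 1); first exact: ultralimit_linear.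
move=> x; rewrite mul1r (le_trans _ (range_projection_le a x))//.
by rewrite -(@ler_pXn2r _ 2) ?nnegrE// !norm_sqrE ultralimit_inner.
Qed.

Definition ultralimit_bop : bop H := Bop ultralimit_bounded.

Lemma limit_partial_isometry : initial_partial_isometries a ultralimit_bop.
Proof.
apply/funext => x; apply: inner_ext => z.
by rewrite [LHS](adjointPl ultralimit_bop) /= ultralimit_inner -range_projection_inner.
Qed.

Lemma cvg_limit y : closure (range a) y ->
  (fun u : bop H => u y) @ U --> ultralimit_bop y.
Proof. by move=> ya; have := @ultralimitP y; rewrite range_projection_id. Qed.

(** The limit exists by compactness.  It is identified by testing against x, as
    <a (u' y), x> = <y, u (a' x)> and a' x is in the closed range of [a]. *)
Lemma cvg_adjoint y :
  (fun u : bop H => a (adjoint u y)) @ U --> a (adjoint ultralimit_bop y).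
Proof.
have /cvg_ex[z uz] : cvg ((fun u : bop H => a (adjoint u y)) @ U).
  apply: (@compact_ultra_cvg a _ U UU _ (1 + `|y|)) => //.
  by apply: filterS Uu => u uu; rewrite unitary_norm_adj// lerDr.
suff <- : z = a (adjoint ultralimit_bop y) by [].
apply: inner_ext => x; rewrite adjointP adjointPl.
have xa := cvg_limit (@normal_adjoint_range _ _ _ x na).
apply: (@cvg_inner_eq _ _ _ U UP _ (cst x) (cst y) _ _ _ _ _ uz _ _ xa);
  try exact: cvg_cst.
by apply: nearW => u; rewrite adjointP adjointPl.
Qed.

Lemma limit_conjugate : b = ultralimit_bop \o a \o adjoint ultralimit_bop :> (H -> H).
Proof.
apply/funext => y /=; set z := a _.
have za : closure (range a) z by apply: subset_closure; exists (adjoint ultralimit_bop y).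
have ub : (fun u : bop H => u (a (adjoint u y))) @ U --> b y.
  apply/cvgrPdist_lt => e e0; have [r r0 ry] := small_multiple y e0.
  apply: filterS (Ub r0) => u /= /(_ y) uy; exact: le_lt_trans uy ry.
apply: (cvg_unique (@norm_hausdorff _ _) ub).
apply/cvgrPdist_lt => e e0; have e2 : 0 < e / 2 by rewrite divr_gt0.
move/cvgrPdist_lt : (cvg_limit za) => /(_ _ e2) uz.
move/cvgrPdist_lt : (@cvg_adjoint y) => /(_ _ e2) ay.
near=> u.
have uu : unitary u by near: u.
have -> : ultralimit_bop z - u (a (adjoint u y))
    = (ultralimit_bop z - u z) + u (z - a (adjoint u y)) by rewrite bopB addrA subrK.
rewrite (splitr e) (le_lt_trans (ler_normD _ _))// ltrD//; first by near: u.
by rewrite unitary_norm//; near: u.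
Unshelve. all: by end_near. Qed.

End Limit.

(** The unitaries conjugating [a] to within e of [b], for e > 0, form a filter base;
    the limit is taken along an ultrafilter containing it. *)
Lemma orbit_closure_conjugate a b : compact_operator a -> normal_operator a ->
  closure (unitary_orbit a) b ->
  exists2 v : bop H, initial_partial_isometries a v &
    b = v \o a \o adjoint v :> (H -> H).
Proof.
move=> ca na /closure_bopP bcl.
pose A (e : R) := [set u : bop H | unitary u /\
   forall x, `|b x - u (a (adjoint u x))| <= e%:C * `|x|].
have FF : ProperFilter (filter_from [set e : R | 0 < e] A).
  apply: filter_from_proper.
    apply: filter_from_filter; first by exists 1 => /=.
    move=> e e' /= e0 e'0; exists (Num.min e e'); first by rewrite /= lt_min e0.
    move=> u [uu ub]; split; split=> // x; apply: le_trans (ub x) _;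
      by rewrite ler_wpM2r// lecR ge_min lexx ?orbT.
  move=> e /= e0; have [c [u uu cE] bc] := bcl _ e0; exists u; split=> // x.
  by have := bc x; rewrite cE.
have [U [UU FU]] := ultraFilterLemma FF.
have Uu : U unitary by apply: FU; exists 1 => //= u [].
have Ub (e : R) : 0 < e ->
    U [set u : bop H | forall x, `|b x - u (a (adjoint u x))| <= e%:C * `|x|].
  by move=> e0; apply: FU; exists e => //= u [].
exists (ultralimit_bop ca UU Uu Ub).
  exact: limit_partial_isometry.
exact: limit_conjugate.
Qed.

End Forward.

Theorem lemma4p3 (R : realType) (H : hilbertType R)
    (sepH : separable_space H) (infH : infinite_dimensional H)
    (a : bop H) (compact_a : compact_operator a) (normal_a : normal_operator a)
    (b : bop H) :
  (closure (unitary_orbit a) b <->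
   exists2 v : bop H, initial_partial_isometries a v
     & b = v \o a \o adjoint v :> (H -> H)) /\
  (forall v : bop H, initial_partial_isometries a v ->
     b = v \o a \o adjoint v :> (H -> H) ->
     a = adjoint v \o b \o v :> (H -> H) /\
     v \o adjoint v = range_projection b).
Proof.
split; first split; first exact: orbit_closure_conjugate.
  by move=> [v va bE]; exact: conjugate_in_orbit_closure va bE.
move=> v va bE; split; first exact: conjugate_recover va bE.
exact: conjugate_final_projection va bE.
Qed.
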